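(* Let $n\ge 2$. The restriction of the mapping $\Phi$ to the set of interval posets of block-wise simple permutations of size $n$ is a bijection onto the set of non-crossing dissections of the convex $(n+1)$-gon in which no triangles or quadrilaterals are present. Consequently, these two sets have the same size.
   Context: Intervals and interval posets. For $\pi\in\mathcal{S}_n$, an interval of $\pi$ is a nonempty set of consecutive values $[a,b]=\{a,a+1,\dots,b\}\subseteq\{1,\dots,n\}$ that appear in consecutive positions of $\pi$ (in some order); $\{1,\dots,n\}$ and all singletons are intervals. The interval poset $P(\pi)$ is the set of all intervals of $\pi$ ordered by inclusion; it is regarded as a concrete family of subsets $[a,b]$ of $\{1,\dots,n\}$ (different permutations may give the same poset). An interval poset with $n$ minimal elements is a poset of the form $P(\pi)$ with $\pi\in\mathcal{S}_n$. Block-wise simple permutations. For permutations $p_1\in\mathcal{S}_k$, $p_2\in\mathcal{S}_\ell$ with $k,\ell\ge 1$, the direct sum $p_1\oplus p_2\in\mathcal{S}_{k+\ell}$ is $p_1$ followed by $p_2$ with all values of $p_2$ increased by $k$; the skew sum $p_1\ominus p_2\in\mathcal{S}_{k+\ell}$ is $p_1$ with all values increased by $\ell$, followed by $p_2$. An interval of $\pi$ is of the form $q$ if the subsequence of $\pi$ consisting of the values in the interval is order-isomorphic to $q$. A permutation $\pi\in\mathcal{S}_n$ is block-wise simple if it has no interval of the form $p_1\oplus p_2$ or $p_1\ominus p_2$ (the whole of $\{1,\dots,n\}$ counts as an interval). Dissections. The vertices of the convex $(n+1)$-gon are labelled $1,\dots,n+1$ in cyclic order; $(i,j)$ denotes the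 segment (diagonal or outer edge) joining vertices $i$ and $j$. A dissection is a set of diagonals of the polygon. Two diagonals cross if they intersect at an interior point; a dissection is non-crossing if no two of its diagonals cross. The graph of the dissection has the polygon's vertices as vertex set, and its edges are the outer edges together with the diagonals of the dissection. A triangle of the dissection is a set of three vertices $a<b<c$ such that $(a,b),(b,c),(a,c)$ are all edges of the graph of the dissection. A quadrilateral of the dissection is a set of four vertices $a<b<c<d$ such that $(a,b),(b,c),(c,d),(a,d)$ are all edges of the graph of the dissection but neither $(a,c)$ nor $(b,d)$ is. The map $\Phi$. For an interval poset $P$ with $n$ minimal elements, $\Phi(P)$ is the dissection of the convex $(n+1)$-gon consisting of the diagonals $(a,b+1)$ for all non-singleton intervals $[a,b]\in P$ (the interval $[1,n]$ gives the outer edge $(1,n+1)$, and singletons $\{a\}$ correspond to the outer edges $(a,a+1)$). *)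

(* Defs.v *)
From HB Require Import structures.
From mathcomp Require Import all_boot all_order all_algebra all_fingroup.
From mathcomp Require Import boolp.

Set Implicit Arguments.
Unset Strict Implicit.
Unset Printing Implicit Defensive.

Import Order.TTheory GRing.Theory Num.Theory.

(* Permutations of size n are elements p of 'S_n, with p i the value at
   position i.  Values, positions and polygon vertices are numbered from 0:
   the value a of the text is a - 1 here, and so is the vertex a. *)

(** ** Intervals and interval posets *)

Definition segment n (a b : 'I_n) : {set 'I_n} := [set x : 'I_n | a <= x <= b].

Definition consecutive n (I : {set 'I_n}) : bool :=
  [exists a : 'I_n, exists b : 'I_n, (a <= b) && (I == segment a b)].

Definition is_interval n (p : 'S_n) (I : {set 'I_n}) : bool :=
  consecutive I && consecutive [set i | p i \in I].

Definition interval_poset n (p : 'S_n) : {set {set 'I_n}} :=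
  [set I | is_interval p I].

(** ** Block-wise simple permutations *)

Definition direct_sum_fun k l (p : 'S_k) (q : 'S_l) (i : 'I_(k + l)) :
    'I_(k + l) :=
  match split i with
  | inl a => lshift l (p a)
  | inr b => rshift k (q b)
  end.

Lemma direct_sum_inj k l (p : 'S_k) (q : 'S_l) :
  injective (direct_sum_fun p q).
Proof.
move=> i j; rewrite /direct_sum_fun -[i]splitK -[j]splitK !unsplitK.
case: (split i) (split j) => a [] b /=.
- by move/lshift_inj/perm_inj ->.
- by move/eqP; rewrite eq_lrshift.
- by move/eqP; rewrite eq_rlshift.
- by move/rshift_inj/perm_inj ->.
Qed.

Definition direct_sum k l (p : 'S_k) (q : 'S_l) : 'S_(k + l) :=
  perm (@direct_sum_inj k l p q).

Definition skew_sum_fun k l (p : 'S_k) (q : 'S_l) (i : 'I_(k + l)) :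
    'I_(k + l) :=
  cast_ord (addnC l k)
    match split i with
    | inl a => rshift l (p a)
    | inr b => lshift k (q b)
    end.

Lemma skew_sum_inj k l (p : 'S_k) (q : 'S_l) : injective (skew_sum_fun p q).
Proof.
move=> i j /cast_ord_inj; rewrite -[i]splitK -[j]splitK !unsplitK.
case: (split i) (split j) => a [] b /=.
- by move/rshift_inj/perm_inj ->.
- by move/eqP; rewrite eq_rlshift.
- by move/eqP; rewrite eq_lrshift.
- by move/lshift_inj/perm_inj ->.
Qed.

Definition skew_sum k l (p : 'S_k) (q : 'S_l) : 'S_(k + l) :=
  perm (@skew_sum_inj k l p q).

(* One-line notation. *)
Definition word n (p : 'S_n) : seq 'I_n := [seq p i | i <- enum 'I_n].

Definition order_isomorphic (s t : seq nat) : Prop :=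
  size s = size t /\
  forall i j, i < size s -> j < size s ->
    (nth 0 s i < nth 0 s j) = (nth 0 t i < nth 0 t j).

Definition of_form n (p : 'S_n) (I : {set 'I_n}) m (q : 'S_m) : Prop :=
  order_isomorphic (map val [seq v <- word p | v \in I]) (map val (word q)).

Definition block_wise_simple n (p : 'S_n) : Prop :=
  forall I : {set 'I_n}, is_interval p I ->
  forall (k l : nat) (p1 : 'S_k) (p2 : 'S_l), 0 < k -> 0 < l ->
    ~ of_form p I (direct_sum p1 p2) /\ ~ of_form p I (skew_sum p1 p2).

Definition block_wise_simple_posets n : {set {set {set 'I_n}}} :=
  [set interval_poset p | p : 'S_n & `[< block_wise_simple p >]].

(** ** Dissections of the convex (n+1)-gon *)

(* The segment joining the vertices i < j is represented by the ordered pair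
   (i, j). *)

Definition outer_edge n (e : 'I_n.+1 * 'I_n.+1) : bool :=
  (e.2 == e.1.+1 :> nat) || (e.1 == 0 :> nat) && (e.2 == n :> nat).

Definition diagonal n (e : 'I_n.+1 * 'I_n.+1) : bool :=
  (e.1 < e.2) && ~~ outer_edge e.

Section Geometry.
Local Open Scope ring_scope.

(* Twice the signed area of the triangle x y z. *)
Definition orientation (R : realFieldType) (x y z : R * R) : R :=
  (y.1 - x.1) * (z.2 - x.2) - (y.2 - x.2) * (z.1 - x.1).

(* The points V 0, ..., V n are, in counterclockwise order, the vertices of a
   (strictly) convex polygon. *)
Definition convex_polygon (R : realFieldType) n (V : 'I_n.+1 -> R * R) : Prop :=
  forall i j k : 'I_n.+1, (i < j < k)%N -> 0 < orientation (V i) (V j) (V k).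

Definition open_segment (R : realFieldType) (x y z : R * R) : Prop :=
  exists t : R, 0 < t < 1 /\
    z = ((1 - t) * x.1 + t * y.1, (1 - t) * x.2 + t * y.2).

Definition crossing (R : realFieldType) n (V : 'I_n.+1 -> R * R)
    (e f : 'I_n.+1 * 'I_n.+1) : Prop :=
  exists z : R * R,
    open_segment (V e.1) (V e.2) z /\ open_segment (V f.1) (V f.2) z.

End Geometry.

Definition dissection n (D : {set 'I_n.+1 * 'I_n.+1}) : Prop :=
  forall e, e \in D -> diagonal e.

Definition non_crossing (R : realFieldType) n (V : 'I_n.+1 -> R * R)
    (D : {set 'I_n.+1 * 'I_n.+1}) : Prop :=
  forall e f, e \in D -> f \in D -> e <> f -> ~ crossing V e f.

(* Only meant for pairs a < b. *)
Definition graph_edge n (D : {set 'I_n.+1 * 'I_n.+1}) (a b : 'I_n.+1) : bool :=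
  outer_edge (a, b) || ((a, b) \in D).

Definition has_triangle n (D : {set 'I_n.+1 * 'I_n.+1}) : Prop :=
  exists a b c : 'I_n.+1, [/\ a < b, b < c &
    [/\ graph_edge D a b, graph_edge D b c & graph_edge D a c]].

Definition has_quadrilateral n (D : {set 'I_n.+1 * 'I_n.+1}) : Prop :=
  exists a b c d : 'I_n.+1, [/\ a < b, b < c, c < d,
    [/\ graph_edge D a b, graph_edge D b c, graph_edge D c d
      & graph_edge D a d]
    & ~~ graph_edge D a c /\ ~~ graph_edge D b d].

Definition tq_free_dissections (R : realFieldType) n (V : 'I_n.+1 -> R * R) :
    {set {set 'I_n.+1 * 'I_n.+1}} :=
  [set D | `[< [/\ dissection D, non_crossing V D,
                   ~ has_triangle D & ~ has_quadrilateral D] >]].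

(** ** The map Phi *)

(* The segment (a, b+1). *)
Definition interval_edge n (a b : 'I_n) : 'I_n.+1 * 'I_n.+1 :=
  (widen_ord (leqnSn n) a, lift ord0 b).

(* The condition that the segment be a diagonal discards the whole interval,
   whose segment is the outer edge (0, n), not a member of the dissection. *)
Definition Phi n (P : {set {set 'I_n}}) : {set 'I_n.+1 * 'I_n.+1} :=
  [set e | diagonal e &
    [exists a : 'I_n, exists b : 'I_n,
      [&& a < b, segment a b \in P & e == interval_edge a b]]].

(* Main.v *)
Require Import Defs.
From mathcomp Require Import all_boot all_order all_algebra all_fingroup.
From mathcomp Require Import boolp zify ring.

(** A set of consecutive values [a, b) (half-open from here on) is an interval
    of [p] when the position function [position p], that is the inverse of [p],
    leaves no foreign value between two of its positions.  This condition,
    [gapfree], only uses the relative order of the positions; so a permutation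
    may be replaced by any injective function [g] from values to naturals, and
    the half-open interval [a, b) is at the same time the edge (a, b) of the
    polygon.

    If a direct or skew sum occupies an interval, its two summands are adjacent
    intervals whose union is an interval, and conversely two adjacent intervals
    whose union is an interval form a sum.  Hence block-wise simple means that
    the edges of [p] contain no triangle ([block_wise_simpleP]).  The other two
    properties follow from this one.  Two overlapping intervals cut each other
    into smaller intervals, which make a triangle ([triangle_free_nested]), so
    no two diagonals cross.  Of three adjacent blocks filling an interval, one
    of the outer two in value, the first or the third, is outermost in
    position, and the remaining two then form an interval
    ([gapfree_three]): so there is no quadrilateral.

    Conversely every non-crossing edge set without triangles and quadrilaterals
    comes from a permutation ([tq_free_realized]), by induction on the number of
    vertices.  A diagonal (a, b) with no other diagonal between its endpoints
    cuts off a cell with at least five sides, that is [m = b - a >= 4].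
    Deleting the vertices strictly between [a] and [b] leaves a smaller edge set
    of the same kind, hence a smaller permutation; its value [a] is then
    inflated into a simple permutation of size [m], and one exists for each
    [m >= 4].  No new interval overlaps the inflated block, because it would cut
    off an interval of that simple permutation.

    Finally, an interval poset contains all singletons and the whole set, so it
    is determined by its diagonals; and in strictly convex position two
    diagonals meet inside the polygon exactly when their endpoints interleave
    ([non_crossingP]). *)

Set Implicit Arguments.
Unset Strict Implicit.
Unset Printing Implicit Defensive.

(** * Sets of consecutive values in consecutive positions *)

Definition gapfree n (g : nat -> nat) a b : Prop :=
  forall x y z, x < n -> a <= y < b -> a <= z < b ->
    g y < g x < g z -> a <= x < b.

Lemma gapfree1 n g a : gapfree n g a a.+1.
Proof. by move=> x y z _ ya za; rewrite (_ : y = z); lia. Qed.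

Lemma gapfree_full n g : gapfree n g 0 n.
Proof. by []. Qed.

Lemma gapfreeI n g i j k l : i <= k -> j <= l ->
  gapfree n g i j -> gapfree n g k l -> gapfree n g k j.
Proof.
move=> ik jl Gij Gkl x y z xn yI zI yxz.
have /andP[_ xj] : i <= x < j by apply: (Gij x y z) => //; lia.
have /andP[kx _] : k <= x < l by apply: (Gkl x y z) => //; lia.
by rewrite kx.
Qed.

(** If a foreign value of [k, j) lay between two positions of [i, k), the value
    [j], which [k, l) shares with it and which lies outside the range of
    positions of [i, j), would drag a position of [i, k) into [k, l). *)
Lemma gapfreeDl n g i j k l : {in gtn n &, injective g} ->
  i <= k < j -> j < l <= n ->
  gapfree n g i j -> gapfree n g k l -> gapfree n g i k.
Proof.
move=> g_inj ikj jln Gij Gkl x y z xn yI zI yxz.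
have xI : i <= x < j by apply: (Gij x y z) => //; lia.
case: (ltnP x k) => kx; first by lia.
have neq v : v < j -> g j <> g v.
  by move=> vj /g_inj; rewrite !inE => /(_ _ _); lia.
have neqy := neq y; have neqz := neq z.
case: (ltnP (g j) (g y)) => gyj.
  by have := Gkl y j x; lia.
case: (ltnP (g z) (g j)) => gzj.
  by have := Gkl z x j; lia.
by have := Gij j y z; lia.
Qed.

Lemma gapfreeDr n g i j k l : {in gtn n &, injective g} ->
  i < k -> k <= j < l -> l <= n ->
  gapfree n g i j -> gapfree n g k l -> gapfree n g j l.
Proof.
move=> g_inj ik kjl ln Gij Gkl x y z xn yI zI yxz.
have xI : k <= x < l by apply: (Gkl x y z) => //; lia.
case: (ltnP x j) => jx; last by lia.
have neq v : j <= v < l -> g i <> g v.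
  by move=> vj /g_inj; rewrite !inE => /(_ _ _); lia.
have neqy := neq y; have neqz := neq z.
case: (ltnP (g i) (g y)) => gyj.
  by have := Gij y i x; lia.
case: (ltnP (g z) (g i)) => gzj.
  by have := Gij z x i; lia.
by have := Gkl i y z; lia.
Qed.

(** * Disjoint blocks of values *)

Definition triangle_free n (E : rel nat) := forall i j k,
  i < j -> j < k <= n -> E i j -> E j k -> E i k -> False.

Definition before (g : nat -> nat) i j k l :=
  forall x y, i <= x < j -> k <= y < l -> g x < g y.

(** Comparing one value of each block decides the comparison of all: exchanging
    one value for another of its block cannot jump over the other block. *)
Lemma blocks_separated n g i j k l : {in gtn n &, injective g} ->
  i < j <= k -> k < l <= n -> gapfree n g i j -> gapfree n g k l ->
  before g i j k l \/ before g k l i j.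
Proof.
move=> g_inj ijk kln Gij Gkl.
have neq x y : i <= x < j -> k <= y < l -> g x <> g y.
  by move=> xI yI /g_inj; rewrite !inE; lia.
have step x x' y y' : i <= x < j -> i <= x' < j -> k <= y < l -> k <= y' < l ->
    g x < g y -> g x' < g y'.
  move=> xI x'I yI y'I xy.
  have x'y : g x' < g y.
    rewrite ltnNge leq_eqVlt.
    apply/negP => /orP[/eqP/esym/(neq _ _ x'I yI)//|yx'].
    by have := Gij y x x' _ xI x'I; rewrite xy yx'; lia.
  rewrite ltnNge leq_eqVlt.
  apply/negP => /orP[/eqP/esym/(neq _ _ x'I y'I)//|y'x'].
  by have := Gkl x' y' y _ y'I yI; rewrite x'y y'x'; lia.
have iI : i <= i < j by lia.
have kI : k <= k < l by lia.
have [lt_ik|] := ltnP (g i) (g k).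
  by left=> x y xI yI; apply: (step i x k y).
rewrite leq_eqVlt => /orP[/eqP/esym/(neq _ _ iI kI)//|lt_ki].
right=> y x yI xI; rewrite ltnNge leq_eqVlt.
apply/negP => /orP[/eqP/(neq _ _ xI yI)//|/(step x i y k xI iI yI kI)].
by rewrite ltnNge ltnW.
Qed.

Lemma gapfree_cutr n g i j k : i <= j <= k -> gapfree n g i k ->
  before g i j j k \/ before g j k i j -> gapfree n g i j.
Proof.
move=> ijk G sep x y z xn yI zI /andP[yx xz].
have xI : i <= x < k by apply: (G x y z); rewrite ?yx; lia.
have [|jx] := ltnP x j; first by lia.
have {}xI : j <= x < k by lia.
by case: sep => sep; [have := sep z x zI xI | have := sep x y xI yI]; lia.
Qed.

Lemma gapfree_cutl n g i j k : i <= j <= k -> gapfree n g i k ->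
  before g i j j k \/ before g j k i j -> gapfree n g j k.
Proof.
move=> ijk G sep x y z xn yI zI /andP[yx xz].
have xI : i <= x < k by apply: (G x y z); rewrite ?yx; lia.
have [xj|] := ltnP x j; last by lia.
have {}xI : i <= x < j by lia.
by case: sep => sep; [have := sep x y xI yI | have := sep z x zI xI]; lia.
Qed.

Lemma before_catl g i j k l m : i <= j <= k ->
  before g i j l m -> before g j k l m -> before g i k l m.
Proof.
move=> ijk A B x y xI yI; have [xj|jx] := ltnP x j; first by apply: A; lia.
by apply: B; lia.
Qed.

Lemma before_catr g i j k l m : i <= j <= k ->
  before g l m i j -> before g l m j k -> before g l m i k.
Proof.
move=> ijk A B y x yI xI; have [xj|jx] := ltnP x j; first by apply: A; lia.
by apply: B; lia.
Qed.

(** There is no simple permutation of size three: among the blocks [i, j),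
    [j, k), [k, l), the first or the last is outermost in position, and
    removing an outermost block from an interval leaves an interval. *)
Lemma gapfree_three n g i j k l : {in gtn n &, injective g} ->
  i < j -> j < k -> k < l <= n ->
  gapfree n g i j -> gapfree n g j k -> gapfree n g k l -> gapfree n g i l ->
  gapfree n g i k \/ gapfree n g j l.
Proof.
move=> g_inj ij jk kln Gij Gjk Gkl Gil.
have ijk : i <= j <= k by lia.
have jkl : j <= k <= l by lia.
have right_extreme : before g i j k l /\ before g j k k l \/
    before g k l i j /\ before g k l j k -> gapfree n g i k.
  move=> H; apply: (@gapfree_cutr _ _ _ _ l) => //; first by lia.
  case: H => -[A B]; first by left; apply: before_catl B.
  by right; apply: before_catr B.
have left_extreme : before g i j j k /\ before g i j k l \/
    before g j k i j /\ before g k l i j -> gapfree n g j l.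
  move=> H; apply: (@gapfree_cutl _ _ i) => //; first by lia.
  case: H => -[A B]; first by left; apply: before_catr B.
  by right; apply: before_catl B.
have sep_ij : before g i j j k \/ before g j k i j.
  by apply: (@blocks_separated n) => //; lia.
have sep_jk : before g j k k l \/ before g k l j k.
  by apply: (@blocks_separated n) => //; lia.
have sep_ik : before g i j k l \/ before g k l i j.
  by apply: (@blocks_separated n) => //; lia.
case: sep_ij sep_jk sep_ik => [A|A] [B|B] [C|C];
  do ?[by left; apply: right_extreme; auto
      |by right; apply: left_extreme; auto].
- by have := A i j; have := B j k; have := C k i; lia.
- by have := A j i; have := B k j; have := C i k; lia.
Qed.

(** Edges (i, j) and (k, l) with i < k < j < l would produce the triangle
    i, k, j, by taking the difference and the intersection of the two sets. *)
Lemma triangle_free_nested n g : {in gtn n &, injective g} ->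
  triangle_free n (fun u v => `[< gapfree n g u v >]) ->
  forall i j k l, i < k < j -> j < l <= n ->
    gapfree n g i j -> gapfree n g k l -> False.
Proof.
move=> g_inj tf i j k l ikj jln Gij Gkl.
apply: (tf i k j); try lia; apply/asboolP => //.
  by apply: gapfreeDl Gij Gkl => //; lia.
by apply: gapfreeI Gij Gkl; lia.
Qed.

(** * Simple permutations of every size at least four *)

(** Positions listing the odd values first and then the even ones, both in
    increasing order, as in 1 3 5 0 2 4.  When [m] is odd the largest value
    [m.-1] is even and would come last, making its complement an interval; it is
    put between 0 and 2 instead, as in 1 3 5 0 6 2 4. *)
Definition simple_pattern m v :=
  if odd v then v else if v == m.-1 then m.+1 else m + v.

Lemma simple_pattern_odd m v : odd v -> simple_pattern m v = v.
Proof. by rewrite /simple_pattern => ->. Qed.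

Lemma simple_pattern_even m v : ~~ odd v -> v < m.-1 ->
  simple_pattern m v = m + v.
Proof. by move=> /negbTE ev vm; rewrite /simple_pattern ev ltn_eqF. Qed.

Lemma simple_pattern_last m : odd m -> simple_pattern m m.-1 = m.+1.
Proof.
by move=> om; rewrite /simple_pattern eqxx (_ : odd m.-1 = false) //; lia.
Qed.

Lemma simple_pattern_lt m v : 4 <= m -> v < m -> simple_pattern m v < m.*2.
Proof. by rewrite /simple_pattern => m4 vm; case: ifP; last case: eqP; lia. Qed.

Lemma simple_pattern_even_ge m v : ~~ odd v -> m <= simple_pattern m v.
Proof. by rewrite /simple_pattern => /negbTE ->; case: eqP; lia. Qed.

Lemma simple_pattern_inj m : 4 <= m ->
  {in gtn m &, injective (simple_pattern m)}.
Proof.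
move=> m4 u v; rewrite !inE /simple_pattern => um vm.
by case ou: (odd u); case ov: (odd v); do ?[case: eqP => ?] => *; lia.
Qed.

(** Two consecutive values lie on both sides of, or at, the position of 0, so a
    non-singleton interval contains 0.  Containing 0 and 1, it contains all odd
    values, which stand between 1 and 0; this forces it to reach the top when
    [m] is even, and when [m] is odd the top stands between 0 and 2. *)
Lemma simple_pattern_gapfree m u v : 4 <= m -> u < v <= m ->
  gapfree m (simple_pattern m) u v -> v = u.+1 \/ (u = 0 /\ v = m).
Proof.
move=> m4 uvm G.
have [|vSu] := eqVneq v u.+1; first by left.
have s0 : simple_pattern m 0 = m by rewrite simple_pattern_even ?addn0 //; lia.
have s1 : simple_pattern m 1 = 1 by rewrite simple_pattern_odd.
right; have [u0|u_gt0] := posnP u; last first.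
  have H o e : odd o -> ~~ odd e -> u <= o < v -> u <= e < v -> False.
    move=> oo ee ouv euv; suff : u <= 0 < v by lia.
    apply: (G 0 o e) => //; first lia.
    (* [o] stands before 0 and [e] after it. *)
    rewrite s0 simple_pattern_odd //.
    have := simple_pattern_even_ge m ee.
    have : simple_pattern m 0 <> simple_pattern m e.
      by move=> /simple_pattern_inj; rewrite !inE; lia.
    rewrite s0; lia.
  by have := H u u.+1; have := H u.+1 u; case: (boolP (odd u)); lia.
subst u; split=> //; apply/eqP; rewrite eqn_leq leqNgt; apply/andP.
split; first lia.
apply/negP => vm.
have H o : odd o -> v <= o < m -> False.
  move=> oo vom; suff : 0 <= o < v by lia.
  by apply: (G o 1 0); rewrite ?s0 ?s1 ?simple_pattern_odd; lia.
case: (boolP (odd m)) => om; last by apply: (H m.-1); lia.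
have [vm1|vm1] := ltnP v m.-1; first by apply: (H m.-2); lia.
have s2 : simple_pattern m 2 = m + 2 by rewrite simple_pattern_even //; lia.
suff : 0 <= m.-1 < v by lia.
by apply: (G m.-1 0 2); rewrite ?s0 ?s2 ?simple_pattern_last; lia.
Qed.

(** * Inflating one point into a simple permutation *)

(** [collapse a m] merges the values of the block [a, a + m) into [a];
    [expand a m] goes the other way on polygon vertices, skipping those strictly
    between [a] and [a + m]. *)
Definition collapse a m x :=
  if x < a then x else if x < a + m then a else x - m.-1.

Definition expand a m u := if u <= a then u else u + m.-1.

(** A lexicographic order: [m.*2] exceeds the positions used by
    [simple_pattern m], so the block decides only between its own values. *)
Definition inflate g a m x :=
  g (collapse a m x) * m.*2 +
  (if a <= x < a + m then simple_pattern m (x - a) else 0).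

Lemma expand_lt n a m u : u < n -> expand a m u < n + m.-1.
Proof. by rewrite /expand; case: ifP; lia. Qed.

Lemma expand_leq n a m u : u <= n -> expand a m u <= n + m.-1.
Proof. by rewrite /expand; case: ifP; lia. Qed.

Lemma expand_mono a m u v : u < v -> expand a m u < expand a m v.
Proof. by rewrite /expand; do !case: ifP; lia. Qed.

Lemma expand_lift n a m u : 0 < m -> a < n -> u <= n + m.-1 ->
  ~~ (a < u < a + m) -> exists2 v, v <= n & u = expand a m v.
Proof.
move=> m_gt0 an un au; exists (if u <= a then u else u - m.-1).
  by case: ifP; lia.
by rewrite /expand; do !case: ifP; lia.
Qed.

Section Inflation.

Variables (n a m : nat) (g : nat -> nat).
Hypotheses (m_ge4 : 4 <= m) (a_lt_n : a < n).
Hypothesis (g_inj : {in gtn n &, injective g}).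

Local Notation c := (collapse a m).
Local Notation d := (expand a m).
Local Notation h := (inflate g a m).

Lemma expandK : cancel d c.
Proof. by move=> u; rewrite /collapse /expand; do !case: ifP; lia. Qed.

Lemma collapse_mem u v x : (d u <= x < d v) = (u <= c x < v).
Proof. by rewrite /collapse /expand; do !case: ifP; lia. Qed.

Lemma collapse_lt x : x < n + m.-1 -> c x < n.
Proof. by rewrite /collapse; do !case: ifP; lia. Qed.

Lemma offset_lt x :
  (if a <= x < a + m then simple_pattern m (x - a) else 0) < m.*2.
Proof. by case: ifP => xI; [apply: simple_pattern_lt|]; lia. Qed.

Lemma inflate_lt x y : g (c x) < g (c y) -> h x < h y.
Proof.
move=> gxy; rewrite /inflate; have := offset_lt x; have := offset_lt y.
move: (if _ then _ else _) (if _ then _ else _) => r s; nia.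
Qed.

Lemma inflate_le x y : h x < h y -> g (c x) <= g (c y).
Proof. by move=> hxy; rewrite leqNgt; apply/negP => /inflate_lt; lia. Qed.

Lemma inflate_block u : u < m -> h (a + u) = g a * m.*2 + simple_pattern m u.
Proof.
move=> um; rewrite /inflate /collapse.
by rewrite ltnNge leq_addr ltn_add2l um addKn.
Qed.

Lemma inflate_inj : {in gtn (n + m.-1) &, injective h}.
Proof.
move=> x y; rewrite !inE => xn yn hxy.
have gxy : g (c x) = g (c y).
  have := @inflate_lt x y; have := @inflate_lt y x; lia.
have cxy : c x = c y by apply: g_inj; rewrite ?inE ?collapse_lt.
case: (boolP ((a <= x < a + m) && (a <= y < a + m))) => [/andP[xI yI]|].
  have [s sm xE] : exists2 s, s < m & x = a + s by exists (x - a); lia.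
  have [t tm yE] : exists2 t, t < m & y = a + t by exists (y - a); lia.
  rewrite xE yE; congr (_ + _).
  apply: (simple_pattern_inj m_ge4); rewrite ?inE //.
  by move: hxy; rewrite xE yE !inflate_block // => /addnI.
by move: cxy; rewrite /collapse; do !case: ifP; lia.
Qed.

Lemma inflate_gapfree_expand u v : u < v <= n ->
  gapfree (n + m.-1) h (d u) (d v) <-> gapfree n g u v.
Proof.
move=> uvn; split=> G x y z xn yI zI /andP[yx xz].
  rewrite -[x]expandK -collapse_mem.
  apply: (G _ (d y) (d z)); rewrite ?expand_lt ?collapse_mem ?expandK //.
  by rewrite !inflate_lt ?expandK.
rewrite collapse_mem in yI; rewrite collapse_mem in zI; rewrite collapse_mem.
have cxn := collapse_lt xn.
have [yx'|] := ltnP (g (c y)) (g (c x)); last first.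
  have := inflate_le yx => le1 le2.
  have <- : c y = c x by apply: g_inj; rewrite ?inE; lia.
  exact: yI.
have [xz'|] := ltnP (g (c x)) (g (c z)); last first.
  have := inflate_le xz => le1 le2.
  have -> : c x = c z by apply: g_inj; rewrite ?inE; lia.
  exact: zI.
by apply: (G _ (c y) (c z)); rewrite ?yx'.
Qed.

Lemma inflate_gapfree_block u v : u < v <= m ->
  gapfree (n + m.-1) h (a + u) (a + v) -> v = u.+1 \/ (u = 0 /\ v = m).
Proof.
move=> uvm G; apply: simple_pattern_gapfree => // x y z xm yI zI yxz.
suff : a + u <= a + x < a + v by lia.
by apply: (G _ (a + y) (a + z)); rewrite ?inflate_block; lia.
Qed.

(** An interval having an endpoint strictly inside the block is either
    contained in the block or cuts it into two intervals, one of which has at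
    least two values since [m >= 4]; the simplicity of the pattern excludes
    both. *)
Lemma inflate_gapfree_overlap u v : u.+2 <= v <= n + m.-1 ->
  (a < u < a + m) || (a < v < a + m) ->
  ~ gapfree (n + m.-1) h u v.
Proof.
move=> uvn over G.
have Gb : gapfree (n + m.-1) h a (a + m).
  have da : d a = a by rewrite /expand leqnn.
  have daS : d a.+1 = a + m by rewrite /expand ltnn; lia.
  have := @inflate_gapfree_expand a a.+1; rewrite da daS.
  by move=> ->; [exact: gapfree1 | lia].
have block s t : s < t <= m -> gapfree (n + m.-1) h (a + s) (a + t) ->
  t = s.+1 \/ (s = 0 /\ t = m) by apply: inflate_gapfree_block.
have [ua|au] := leqP u a.
  have Gi : gapfree (n + m.-1) h a v.
    by apply: (@gapfreeI _ _ u v a (a + m)) => //; lia.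
  have := block 0 (v - a); rewrite addn0 subnKC; last by lia.
  move=> /(_ _ Gi) vE.
  have Gd : gapfree (n + m.-1) h v (a + m).
    have [ua'|ua'] := eqVneq u a; first by subst u; have := vE; lia.
    by apply: (@gapfreeDr _ _ u v a (a + m)) => //; try apply: inflate_inj; lia.
  have := block (v - a) m; rewrite subnKC; last by lia.
  by move=> /(_ _ Gd); lia.
have [vb|bv] := leqP v (a + m).
  have := block (u - a) (v - a); rewrite !subnKC; try lia.
  by move=> /(_ _ G); lia.
have Gi : gapfree (n + m.-1) h u (a + m).
  by apply: (@gapfreeI _ _ a (a + m) u v) => //; lia.
have := block (u - a) m; rewrite !subnKC; try lia.
move=> /(_ _ Gi) uE.
have Gd : gapfree (n + m.-1) h a u.
  by apply: (@gapfreeDl _ _ a (a + m) u v) => //; try apply: inflate_inj; lia.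
have := block 0 (u - a); rewrite addn0 !subnKC; try lia.
by move=> /(_ _ Gd); lia.
Qed.

End Inflation.

(** Edges, sides included, of a non-crossing dissection with neither triangles
    nor quadrilaterals, on the vertices 0, ..., n.  All conditions but the first
    two are universal, so that they pass to subsets of the vertices. *)
Record tq_free n (E : rel nat) : Prop := TqFree {
  side_edge : forall i, i < n -> E i i.+1;
  long_edge : E 0 n;
  edges_nested : forall i j k l,
    i < k < j -> j < l <= n -> E i j -> E k l -> False;
  no_triangle : forall i j k,
    i < j -> j < k <= n -> E i j -> E j k -> E i k -> False;
  no_quadrilateral : forall i j k l, i < j -> j < k -> k < l <= n ->
    E i j -> E j k -> E k l -> E i l -> E i k || E j l }.

(** Deleting vertices preserves the universal conditions; the edge (a, a + m)
    becomes the side that the deleted vertices leave open. *)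
Lemma tq_free_collapse n a m (E : rel nat) : 4 <= m -> a < n -> E a (a + m) ->
  tq_free (n + m.-1) E ->
  tq_free n (fun u v => E (expand a m u) (expand a m v)).
Proof.
move=> m4 an Eab [Es El En Et Eq].
have mono := @expand_mono a m; have bound := @expand_leq n a m.
split.
- move=> i i_n; have [->|ia] := eqVneq i a.
    by rewrite /expand leqnn ltnn (_ : a.+1 + m.-1 = a + m) //; lia.
  suff -> : expand a m i.+1 = (expand a m i).+1.
    by apply: Es; apply: expand_lt.
  by rewrite /expand; do !case: ifP; lia.
- by rewrite (_ : expand a m n = n + m.-1) // /expand leqNgt an.
- move=> i j k l /andP[ik kj] /andP[jl ln].
  by apply: En; rewrite !mono // bound.
- move=> i j k ij /andP[jk kn].
  by apply: Et; rewrite !mono // bound.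
- move=> i j k l ij jk /andP[kl ln].
  by apply: Eq; rewrite !mono // bound.
Qed.

Lemma minimal_edge n (E : rel nat) : 1 < n -> E 0 n -> exists a b,
  [/\ a.+2 <= b, b <= n, E a b &
      forall u v, a <= u -> u.+2 <= v <= b -> E u v -> u = a /\ v = b].
Proof.
move=> n1 E0n.
pose P w := (1 < w) && [exists a : 'I_n.+1, (a + w <= n) && E a (a + w)].
have exP : exists w, P w.
  by exists n; rewrite /P n1; apply/existsP; exists ord0; rewrite leqnn.
case: (ex_minnP exP) => w /andP[w1 /existsP[a /andP[awn Eaw]]] min_w.
exists a, (a + w); split=> //; first by lia.
move=> u v au uvb Euv.
suff : w <= v - u by lia.
apply: min_w; apply/andP; split; first by lia.
have un : u < n.+1 by lia.
by apply/existsP; exists (Ordinal un); rewrite /= subnKC ?Euv; lia.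
Qed.

(** Contract the innermost edge (a, b), realize the smaller edge set and inflate
    the value [a].  The innermost edge spans at least four sides, as otherwise
    it would close a triangle or a quadrilateral with them. *)
Lemma tq_free_realized n (E : rel nat) : 0 < n -> tq_free n E ->
  exists2 g : nat -> nat, {in gtn n &, injective g} &
    forall u v, u < v <= n -> E u v <-> gapfree n g u v.
Proof.
have [N] := ubnP n; elim: N n E => // N IH n E nN n_gt0 tqE.
have [n1|n1] := leqP n 1.
  exists id => // u v uvn; have [-> ->] : u = 0 /\ v = 1 by lia.
  by split=> _; [exact: gapfree1 | apply: side_edge tqE _ _].
have [a [b [ab bn Eab min_ab]]] := minimal_edge n1 (long_edge tqE).
pose m := b - a; pose n' := n - m.-1.
have bE : b = a + m by rewrite /m; lia.
have nE : n = n' + m.-1 by rewrite /n' /m; lia.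
have inner u v : a <= u -> u.+2 <= v <= b -> u != a \/ v != b -> ~~ E u v.
  by move=> au uvb uv; apply/negP => /(min_ab _ _ au uvb); lia.
have unit i : i < n -> E i i.+1 by apply: side_edge tqE _.
have m4 : 4 <= m.
  rewrite leqNgt; apply/negP => m3.
  (* Two sides would give a triangle, three a quadrilateral. *)
  have [b2|b3] : b = a.+2 \/ b = a.+3 by lia.
    by apply: (no_triangle tqE (i := a) (j := a.+1) (k := b));
      rewrite ?b2 ?unit -?b2; lia.
  have := no_quadrilateral tqE (i := a) (j := a.+1) (k := a.+2) (l := b).
  rewrite (negbTE (inner a a.+2 _ _ _)) ?(negbTE (inner a.+1 b _ _ _)); try lia.
  by rewrite b3 !unit -?b3 //; lia.
have an' : a < n' by rewrite /n'; lia.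
have tqE' : tq_free n' (fun u v => E (expand a m u) (expand a m v)).
  by apply: tq_free_collapse; rewrite -?bE -?nE.
have [||g g_inj gE] := IH n' _ _ _ tqE'; [by lia|by lia|].
exists (inflate g a m); first by rewrite nE; apply: inflate_inj.
move=> u v uvn; have [->|vSu] := eqVneq v u.+1.
  by split=> _; [exact: gapfree1 | apply: unit; lia].
rewrite nE.
have [cut|] := boolP ((a < u < a + m) || (a < v < a + m)).
  split=> [Euv|]; last by case/(inflate_gapfree_overlap m4 an' g_inj); lia.
  have nest i j k l : i < k < j -> j < l <= n -> E i j -> E k l -> False.
    exact: edges_nested tqE _ _ _ _.
  have au : a <= u.
    by rewrite leqNgt; apply/negP => ua; apply: (nest u v a b); lia.
  have vb : v <= b.
    by rewrite leqNgt; apply/negP => bv; apply: (nest a b u v); lia.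
  by have := inner u v au; rewrite Euv; lia.
rewrite negb_or => /andP[ua va].
have [||u' u'n uE] := @expand_lift n' a m u _ an' _ ua; try lia.
have [||v' v'n vE] := @expand_lift n' a m v _ an' _ va; try lia.
have u'v' : u' < v'.
  have := @expand_mono a m v' u'; rewrite -uE -vE.
  case: (ltngtP u' v') => // [_ |u'v' _]; first by lia.
  by move: uvn; rewrite uE vE u'v'; lia.
rewrite uE vE; rewrite inflate_gapfree_expand ?gE //; lia.
Qed.

(** * Permutations and their intervals *)

(** Send [i] to the number of indices with a smaller value. *)
Lemma standardization n (f : 'I_n -> nat) : injective f ->
  exists p : 'S_n, forall i j, (p i < p j) = (f i < f j).
Proof.
move=> f_inj; pose below i := [set j | f j < f i].
have below_lt i : #|below i| < n.
  rewrite -[n in _ < n]card_ord -cardsT proper_card // properE subsetT.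
  by apply/subsetPn; exists i; rewrite // inE ltnn.
have below_mono i j : f i < f j -> #|below i| < #|below j|.
  move=> ij; apply: proper_card; rewrite properE; apply/andP; split.
    by apply/subsetP => k; rewrite !inE => /ltn_trans; apply.
  by apply/subsetPn; exists i; rewrite inE ?ltnn.
pose r i := Ordinal (below_lt i).
have rE i j : (r i < r j) = (f i < f j).
  rewrite /=; have [/below_mono//|/below_mono|/f_inj ->] := ltngtP (f i) (f j);
    last by rewrite ltnn.
  by move=> /ltnW; rewrite leqNgt => /negbTE.
have r_inj : injective r.
  move=> i j eq_r; apply: f_inj; have := rE i j; have := rE j i.
  by rewrite eq_r ltnn; lia.
by exists (perm r_inj) => i j; rewrite !permE.
Qed.

Lemma consecutiveP n (I : {set 'I_n}) : reflect
  (I != set0 /\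
   forall i j k : 'I_n, i \in I -> k \in I -> i <= j <= k -> j \in I)
  (consecutive I).
Proof.
apply: (iffP existsP) =>
  [[a /existsP[b /andP[ab /eqP ->]]]|[/set0Pn[x xI] conv]].
  split; first by apply/set0Pn; exists a; rewrite inE leqnn.
  by move=> i j k; rewrite !inE; lia.
case: (arg_minnP (fun i : 'I_n => i : nat) xI) => a aI amin.
case: (arg_maxnP (fun i : 'I_n => i : nat) xI) => b bI bmax.
exists a; apply/existsP; exists b; rewrite amin //=.
apply/eqP/setP => i; rewrite inE; apply/idP/idP => [iI|].
  by rewrite amin //=; exact: bmax.
exact: conv.
Qed.

Lemma size_word n (p : 'S_n) : size (word p) = n.
Proof. by rewrite size_map size_enum_ord. Qed.

Lemma nth_word n (p : 'S_n) (i : 'I_n) :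
  nth 0 [seq val v | v <- word p] i = p i.
Proof.
by rewrite -map_comp (nth_map i) ?size_enum_ord //= nth_ord_enum.
Qed.

Definition position n (p : 'S_n) : nat -> nat :=
  nth 0 [seq val i | i <- word p^-1%g].

Lemma positionE n (p : 'S_n) (v : 'I_n) : position p v = (p^-1)%g v.
Proof. exact: nth_word. Qed.

Lemma position_perm n (p : 'S_n) (i : 'I_n) : position p (p i) = i.
Proof. by rewrite positionE permK. Qed.

Lemma position_inj n (p : 'S_n) : {in gtn n &, injective (position p)}.
Proof.
move=> u v; rewrite !inE => un vn.
rewrite -[u]/(val (Ordinal un)) -[v]/(val (Ordinal vn)) !positionE.
by move=> /val_inj/perm_inj ->.
Qed.

Lemma interval_gapfree n (p : 'S_n) a b : a < b <= n ->
  is_interval p [set x : 'I_n | a <= x < b] <-> gapfree n (position p) a b.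
Proof.
move=> /andP[ab bn]; set I := [set x : 'I_n | _].
have an : a < n by apply: leq_trans bn.
have aI : Ordinal an \in I by rewrite inE /= leqnn.
split=> [/andP[_ /consecutiveP[_ conv]] x y z xn yI zI /andP[yx xz]|G].
  have yn : y < n by lia.
  have zn : z < n by lia.
  have pos v (vn : v < n) : position p v = (p^-1)%g (Ordinal vn).
    exact: (positionE p (Ordinal vn)).
  rewrite (pos y yn) (pos x xn) in yx; rewrite (pos x xn) (pos z zn) in xz.
  have := conv _ _ _ _ _ (introT andP (conj (ltnW yx) (ltnW xz))).
  by rewrite !inE !permKV; apply.
apply/andP; split; apply/consecutiveP; split.
- by apply/set0Pn; exists (Ordinal an).
- by move=> i j k; rewrite !inE; lia.
- by apply/set0Pn; exists ((p^-1)%g (Ordinal an)); rewrite inE permKV.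
move=> i j k; rewrite !inE => iI kI /andP[ij jk].
have [<-//|ni] := eqVneq i j; have [->//|nk] := eqVneq j k.
apply: (G _ (p i) (p k)) => //.
by rewrite !position_perm !ltn_neqAle ij jk ni nk.
Qed.

Definition interval_rel n (p : 'S_n) a b : bool :=
  `[< gapfree n (position p) a b >].

Lemma interval_rel_in n (p : 'S_n) a b : a < b <= n ->
  ([set x : 'I_n | a <= x < b] \in interval_poset p) = interval_rel p a b.
Proof.
move=> abn; rewrite inE; apply/idP/asboolP; by rewrite -interval_gapfree.
Qed.

(** * Direct and skew sums *)

Definition block_sum (b : bool) k l (p : 'S_k) (q : 'S_l) : 'S_(k + l) :=
  if b then direct_sum p q else skew_sum p q.

(** The comparison between a value of the first summand and one of the second:
    [true] stands for direct sums, [false] for skew sums. *)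
Definition ltn_dir (b : bool) (x y : nat) := if b then x < y else y < x.

Definition splits b (s : seq nat) : Prop :=
  exists s1 s2, [/\ s = s1 ++ s2, s1 != [::], s2 != [::] &
    forall x y, x \in s1 -> y \in s2 -> ltn_dir b x y].

Lemma ltn_dir_lt b x y x' y' :
  ltn_dir b x y -> ltn_dir b x' y' -> (x < y) = (x' < y').
Proof. by case: b; rewrite /ltn_dir; lia. Qed.

Lemma ltn_dir_gt b x y x' y' :
  ltn_dir b x y -> ltn_dir b x' y' -> (y < x) = (y' < x').
Proof. by case: b; rewrite /ltn_dir; lia. Qed.

Lemma block_sum_ll b k l (p : 'S_k) (q : 'S_l) i j :
  (block_sum b p q (lshift l i) < block_sum b p q (lshift l j)) = (p i < p j).
Proof.
case: b; rewrite !permE /direct_sum_fun /skew_sum_fun.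
  by rewrite -![lshift l _]/(unsplit (inl _)) !unsplitK.
by rewrite -![lshift l _]/(unsplit (inl _)) !unsplitK /= ltn_add2l.
Qed.

Lemma block_sum_rr b k l (p : 'S_k) (q : 'S_l) i j :
  (block_sum b p q (rshift k i) < block_sum b p q (rshift k j)) = (q i < q j).
Proof.
case: b; rewrite !permE /direct_sum_fun /skew_sum_fun.
  by rewrite -![rshift k _]/(unsplit (inr _)) !unsplitK /= ltn_add2l.
by rewrite -![rshift k _]/(unsplit (inr _)) !unsplitK /=.
Qed.

Lemma block_sum_lr b k l (p : 'S_k) (q : 'S_l) i j :
  ltn_dir b (block_sum b p q (lshift l i)) (block_sum b p q (rshift k j)).
Proof.
case: b; rewrite /ltn_dir !permE /direct_sum_fun /skew_sum_fun;
  rewrite -[lshift l _]/(unsplit (inl _)) -[rshift k _]/(unsplit (inr _));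
  rewrite !unsplitK /=.
  exact: ltn_addr.
exact: ltn_addr.
Qed.

(** The summands are obtained by standardizing the two parts of the split. *)
Lemma order_isomorphic_block_sum b (s : seq nat) : uniq s ->
  (exists k l (p : 'S_k) (q : 'S_l), [/\ 0 < k, 0 < l &
     order_isomorphic s [seq val v | v <- word (block_sum b p q)]]) <->
  splits b s.
Proof.
move=> s_uniq; split.
  case=> k [l [p [q [k_gt0 l_gt0 [sz iso]]]]].
  rewrite size_map size_word in sz.
  exists (take k s), (drop k s); split.
  - by rewrite cat_take_drop.
  - by rewrite -size_eq0 size_take sz; case: ifP; lia.
  - by rewrite -size_eq0 size_drop sz; lia.
  move=> x y /(nthP 0)[i]; rewrite size_take => ik <- /(nthP 0)[j].
  rewrite size_drop sz addKn => jl <-.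
  have {}ik : i < k by move: ik; case: ifP; lia.
  rewrite nth_take // nth_drop.
  have := block_sum_lr b p q (Ordinal ik) (Ordinal jl).
  by case: b iso => iso; rewrite /ltn_dir -!nth_word /= iso ?sz //; lia.
case=> s1 [s2 [sE s1n s2n lt12]]; exists (size s1), (size s2).
move: s_uniq; rewrite sE cat_uniq => /and3P[u1 _ u2].
have inj1 : injective (fun i : 'I_(size s1) => nth 0 s1 i).
  by move=> i j /eqP; rewrite nth_uniq // => /eqP/val_inj.
have inj2 : injective (fun i : 'I_(size s2) => nth 0 s2 i).
  by move=> i j /eqP; rewrite nth_uniq // => /eqP/val_inj.
have [p pE] := standardization inj1; have [q qE] := standardization inj2.
exists p, q; split; rewrite ?lt0n ?size_eq0 //; split.
  by rewrite size_map size_word size_cat.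
rewrite size_cat => i j ik jk.
rewrite -[i]/(val (Ordinal ik)) -[j]/(val (Ordinal jk)) !nth_word.
have nthl (a : 'I_(size s1)) :
    nth 0 (s1 ++ s2) (lshift (size s2) a) = nth 0 s1 a.
  by rewrite nth_cat /= ltn_ord.
have nthr (a : 'I_(size s2)) :
    nth 0 (s1 ++ s2) (rshift (size s1) a) = nth 0 s2 a.
  by rewrite nth_cat /= ltnNge leq_addr addKn.
case: (split_ordP (Ordinal ik)) => a ->;
  case: (split_ordP (Ordinal jk)) => c ->.
- by rewrite !nthl block_sum_ll pE.
- rewrite nthl nthr; have := block_sum_lr b p q a c.
  have := lt12 _ _ (mem_nth 0 (ltn_ord a)) (mem_nth 0 (ltn_ord c)).
  exact: ltn_dir_lt.
- rewrite nthl nthr; have := block_sum_lr b p q c a.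
  have := lt12 _ _ (mem_nth 0 (ltn_ord c)) (mem_nth 0 (ltn_ord a)).
  exact: ltn_dir_gt.
- by rewrite !nthr block_sum_rr qE.
Qed.

Lemma filter_cat_separated (g : nat -> nat) (s : seq nat) (P : pred nat) :
  pairwise (fun x y => g x < g y) s ->
  (forall x y, x \in s -> y \in s -> P x -> ~~ P y -> g x < g y) ->
  s = filter P s ++ filter (predC P) s.
Proof.
elim: s => //= x s IH /andP[x_lt s_lt] sep.
have {}IH : s = filter P s ++ filter (predC P) s.
  by apply: IH => // y z ys zs; apply: sep; rewrite inE ?ys ?zs orbT.
have [Px|nPx] /= := boolP (P x); first by rewrite {1}IH.
have noP : all (predC P) s.
  apply/allP => y ys /=; apply/negP => Py.
  have := sep y x; rewrite !inE eqxx ys orbT => /(_ isT isT Py nPx).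
  by have := allP x_lt y ys; lia.
have -> : filter P s = [::].
  by apply/eqP; rewrite -(negbK (_ == _)) -has_filter -all_predC.
by rewrite (all_filterP noP).
Qed.

Definition subword n (p : 'S_n) (I : {set 'I_n}) : seq nat :=
  [seq val v | v <- [seq v <- word p | v \in I]].

Lemma subword_uniq n (p : 'S_n) I : uniq (subword p I).
Proof.
rewrite map_inj_uniq; last exact: val_inj.
by rewrite filter_uniq // map_inj_uniq ?enum_uniq //; apply: perm_inj.
Qed.

Lemma mem_subword n (p : 'S_n) a b x : b <= n ->
  (x \in subword p [set v : 'I_n | a <= v < b]) = (a <= x < b).
Proof.
move=> bn; apply/mapP/idP => [[v]|xI].
  by rewrite mem_filter inE => /andP[vI _] ->.
have xn : x < n by lia.
exists (Ordinal xn) => //; rewrite mem_filter inE xI /=.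
by apply/mapP; exists ((p^-1)%g (Ordinal xn)); rewrite ?mem_enum ?permKV.
Qed.

Lemma subword_sorted n (p : 'S_n) I :
  pairwise (fun x y => position p x < position p y) (subword p I).
Proof.
rewrite pairwise_map; apply: pairwise_filter; rewrite pairwise_map.
have : pairwise (relpre val ltn) (enum 'I_n).
  rewrite -(pairwise_map _ ltn) val_enum_ord -sorted_pairwise.
    exact: iota_ltn_sorted.
  exact: ltn_trans.
by apply: sub_pairwise => i j /=; rewrite !position_perm.
Qed.

(** In one direction the two blocks are separated in position, so the values
    listed in order of position form one block followed by the other.
    Conversely the least value [j] of the upper part of a split separates the
    values of the two parts. *)
Lemma triangle_subword n (p : 'S_n) i k : i < k <= n ->
  gapfree n (position p) i k ->
  (exists j, [/\ i < j, j < k, gapfree n (position p) i j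
               & gapfree n (position p) j k]) <->
  (exists b, splits b (subword p [set v : 'I_n | i <= v < k])).
Proof.
move=> /andP[ik kn] Gik; set s := subword p _.
have s_sorted : pairwise (fun x y => position p x < position p y) s.
  exact: subword_sorted.
have sI x : (x \in s) = (i <= x < k) by apply: mem_subword.
split.
  case=> j [ij jk Gij Gjk].
  have nonempty (P : pred nat) x : P x -> x \in s -> filter P s != [::].
    by move=> Px xs; rewrite -has_filter; apply/hasP; exists x.
  have := blocks_separated (@position_inj _ p) (_ : i < j <= j)
    (_ : j < k <= n) Gij Gjk.
  have -> : i < j <= j by lia.
  have -> : j < k <= n by lia.
  move=> /(_ isT isT)[] sep.
    exists true, (filter (gtn j) s), (filter (predC (gtn j)) s); split.
    - apply: filter_cat_separated s_sorted _ => x y.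
      rewrite !sI /= => xI yI xj yj.
      by apply: sep; lia.
    - by apply: (nonempty _ i); rewrite /= ?sI; lia.
    - by apply: (nonempty _ j); rewrite /= ?sI; lia.
    - by move=> x y; rewrite !mem_filter /=; lia.
  exists false, (filter (leq j) s), (filter (predC (leq j)) s); split.
  - apply: filter_cat_separated s_sorted _ => x y.
    rewrite !sI /= => xI yI xj yj.
    by apply: sep; lia.
  - by apply: (nonempty _ j); rewrite /= ?sI; lia.
  - by apply: (nonempty _ i); rewrite /= ?sI; lia.
  - by move=> x y; rewrite !mem_filter /=; lia.
case=> b [s1 [s2 [sE s1n s2n lt12]]].
pose lo := if b then s1 else s2; pose hi := if b then s2 else s1.
have sP x : (i <= x < k) = (x \in lo) || (x \in hi).
  by rewrite -sI sE mem_cat /lo /hi; case: (b) => //; rewrite orbC.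
have lt_lohi x y : x \in lo -> y \in hi -> x < y.
  by rewrite /lo /hi; move: lt12; case: (b) => lt12 xs ys; apply: lt12.
have [x0 x0lo] : exists x, x \in lo.
  by rewrite /lo; case: (b); [case: (s1) s1n | case: (s2) s2n] => // x t _;
    exists x; rewrite mem_head.
have ex_hi : exists x, x \in hi.
  by rewrite /hi; case: (b); [case: (s2) s2n | case: (s1) s1n] => // x t _;
    exists x; rewrite mem_head.
case: (ex_minnP ex_hi) => j jhi min_j.
have loE x : i <= x < j -> x \in lo.
  move=> xI; have : i <= x < k by have := sP j; rewrite jhi orbT; lia.
  by rewrite sP => /orP[//|/min_j]; lia.
have hiE x : j <= x < k -> x \in hi.
  move=> xI; have : i <= x < k by have := sP j; rewrite jhi orbT; lia.
  by rewrite sP => /orP[/lt_lohi/(_ jhi)|//]; lia.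
have x0j := lt_lohi _ _ x0lo jhi.
have x0I : i <= x0 < k by rewrite sP x0lo.
have jI : i <= j < k by rewrite sP jhi orbT.
have sep : before (position p) i j j k \/ before (position p) j k i j.
  move: s_sorted; rewrite sE pairwise_cat => /and3P[/allrelP sorted12 _ _].
  move: loE hiE; rewrite /lo /hi; case: (b) => loE hiE;
    [left|right] => x y xI yI;
    by apply: sorted12; auto.
exists j; split; try lia.
  by apply: gapfree_cutr Gik sep; lia.
by apply: gapfree_cutl Gik sep; lia.
Qed.

(** Being a sum means that the one-line notation splits into two parts with all
    values of one below all values of the other; inside an interval this is a
    splitting into two adjacent intervals. *)
Lemma block_wise_simpleP n (p : 'S_n) :
  block_wise_simple p <-> triangle_free n (interval_rel p).
Proof.
split=> [bws i j k ij /andP[jk kn] /asboolP Gij /asboolP Gjk /asboolP Gik|tf I].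
  have ikn : i < k <= n by lia.
  have [b split_b] : exists b, splits b (subword p [set v : 'I_n | i <= v < k]).
    by apply/triangle_subword => //; exists j.
  have := order_isomorphic_block_sum b
    (subword_uniq p [set v : 'I_n | i <= v < k]).
  case=> _ /(_ split_b) [k' [l' [q [r [k_gt0 l_gt0 iso]]]]].
  have intI : is_interval p [set v : 'I_n | i <= v < k].
    by apply/interval_gapfree.
  have [] := bws _ intI k' l' q r k_gt0 l_gt0.
  by case: b {split_b} iso.
move=> intI.
have [a [b [ab IE]]] : exists a b : 'I_n,
    a <= b /\ I = [set v : 'I_n | a <= v < b.+1].
  case/andP: (intI) => /existsP[a /existsP[b /andP[ab /eqP ->]]] _.
  by exists a, b; split.
have abn : a < b.+1 <= n by rewrite ltnS ab ltn_ord.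
have Gab : gapfree n (position p) a b.+1 by rewrite -interval_gapfree -?IE.
move=> k l q r k_gt0 l_gt0.
have no_form c : ~ of_form p I (block_sum c q r).
  move=> form; have [j [aj jb Gaj Gjb]] : exists j, [/\ a < j, j < b.+1,
      gapfree n (position p) a j & gapfree n (position p) j b.+1].
    apply/triangle_subword => //; exists c.
    apply/order_isomorphic_block_sum; first exact: subword_uniq.
    by exists k, l, q, r; rewrite -IE.
  apply: (tf a j b.+1) => //; try (by apply/asboolP); lia.
by split; [apply: (no_form true) | apply: (no_form false)].
Qed.

(** * Crossing diagonals of a convex polygon *)

Definition interleaved (i j k l : nat) := (i < k < j) && (j < l).

Section Geometry.
Import Order.TTheory GRing.Theory Num.Theory.
Local Open Scope ring_scope.

Variables (R : realFieldType) (n : nat) (V : 'I_n.+1 -> R * R).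
Hypothesis hV : convex_polygon V.

Local Notation side i j x := (orientation (V i) (V j) (V x)).

Lemma orientation_rot (x y z : R * R) : orientation x y z = orientation z x y.
Proof. by rewrite /orientation; ring. Qed.

Lemma orientation_swap (x y z : R * R) :
  orientation x y z = - orientation x z y.
Proof. by rewrite /orientation; ring. Qed.

Lemma side_outside (i j x : 'I_n.+1) :
  (i < j)%N -> (x < i)%N || (j < x)%N -> 0 < side i j x.
Proof.
move=> ij /orP[xi|jx]; last by apply: hV; rewrite ij.
by rewrite orientation_rot; apply: hV; rewrite xi.
Qed.

Lemma side_inside (i j x : 'I_n.+1) : (i < x < j)%N -> side i j x < 0.
Proof. by move=> ixj; rewrite orientation_swap oppr_lt0; apply: hV. Qed.

Lemma side_endpoint (i j x : 'I_n.+1) : (x == i) || (x == j) -> side i j x = 0.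
Proof. by case/orP => /eqP ->; rewrite /orientation; ring. Qed.

Lemma orientation_segment (x y u v : R * R) (t : R) :
  orientation x y ((1 - t) * u.1 + t * v.1, (1 - t) * u.2 + t * v.2) =
  (1 - t) * orientation x y u + t * orientation x y v.
Proof. by rewrite /orientation /=; ring. Qed.

(** A common point has zero area with V i and V j, and is a proper convex
    combination of V k and V l.  The segments being distinct, V k and V l lie
    strictly on opposite sides of the line through V i and V j: exactly one of k
    and l is strictly between i and j, and neither is equal to i or j. *)
Lemma crossing_interleaved (i j k l : 'I_n.+1) : (i < j)%N -> (k < l)%N ->
  (i, j) <> (k, l) -> crossing V (i, j) (k, l) ->
  interleaved i j k l || interleaved k l i j.
Proof.
move=> ij kl ne [z [[s [_ zs]] [t [/andP[t0 t1] zt]]]].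
have z0 : (1 - t) * side i j k + t * side i j l = 0.
  rewrite -orientation_segment -zt zs orientation_segment /orientation /=; ring.
rewrite -[_ || _]negbK; apply/negP => nint.
have {ne} ne : (i != k :> nat) || (j != l :> nat).
  rewrite -negb_and; apply/negP => /andP[/eqP/val_inj ik /eqP/val_inj jl].
  by apply: ne; rewrite ik jl.
have t1' : 0 < 1 - t by rewrite subr_gt0.
have comb_gt0 (a b : R) : 0 <= a -> 0 <= b -> (0 < a) || (0 < b) ->
    0 < (1 - t) * a + t * b.
  move=> a0 b0 /orP[a1|b1]; [apply: ltr_pwDl|apply: ltr_wpDl];
  by rewrite ?mulr_gt0 ?mulr_ge0 // ltW.
have [out|] := boolP [&& (k <= i) || (j <= k) & (l <= i) || (j <= l)]%N.
  have pos (x : 'I_n.+1) : (x <= i)%N || (j <= x)%N -> 0 <= side i j x.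
    move=> xo; have [/side_endpoint ->//|] := boolP ((x == i) || (x == j)).
    rewrite negb_or -!val_eqE /= => xij; apply/ltW/side_outside => //; lia.
  case/andP: out => ko lo.
  have : 0 < (1 - t) * side i j k + t * side i j l.
    apply: comb_gt0; rewrite ?pos //.
    have [k'|] := boolP ((k < i) || (j < k))%N; first by rewrite side_outside.
    have [l'|] := boolP ((l < i) || (j < l))%N.
      by rewrite (side_outside ij l') orbT.
    by move: ne kl; lia.
  by rewrite z0 ltxx.
move=> nout.
have neg (x : 'I_n.+1) : (i <= x <= j)%N -> 0 <= - side i j x.
  move=> xo; have [/side_endpoint ->|] := boolP ((x == i) || (x == j)).
    by rewrite oppr0.
  rewrite negb_or -!val_eqE /= => xij.
  by rewrite oppr_ge0; apply/ltW/side_inside; lia.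
have : 0 < (1 - t) * - side i j k + t * - side i j l.
  apply: comb_gt0; rewrite ?neg ?oppr_gt0 //;
    try by move: nint nout; rewrite /interleaved; lia.
  have [k'|] := boolP (i < k < j)%N; first by rewrite (side_inside k').
  have [l'|] := boolP (i < l < j)%N; first by rewrite (side_inside l') orbT.
  by move: nint nout; rewrite /interleaved; lia.
by rewrite !mulrN -opprD z0 oppr0 ltxx.
Qed.

(** The meeting point of the diagonals of a convex quadrilateral divides each
    of them in the ratio of the areas of the two triangles into which the other
    diagonal cuts the quadrilateral; [sum_eq] computes the total area in two
    ways. *)
Lemma open_segment_meet (a b c d : R * R) :
  0 < orientation a b c -> 0 < orientation a c d ->
  0 < orientation a b d -> 0 < orientation b c d ->
  exists z, open_segment a c z /\ open_segment b d z.
Proof.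
move=> abc acd abd bcd.
have sum_eq : orientation a b d + orientation b c d =
    orientation a b c + orientation a c d.
  by rewrite /orientation; ring.
have w0 : 0 < orientation a b c + orientation a c d by rewrite addr_gt0.
pose w := orientation a b c + orientation a c d.
pose t := orientation a b d / w; pose s := orientation a b c / w.
have w_neq0 : w != 0 by rewrite gt_eqF.
exists ((1 - t) * a.1 + t * c.1, (1 - t) * a.2 + t * c.2); split.
  exists t; split=> //; rewrite /t divr_gt0 // ltr_pdivrMr // mul1r /w -sum_eq.
  by rewrite ltrDl.
exists s; split; first by rewrite /s divr_gt0 // ltr_pdivrMr // mul1r /w ltrDl.
rewrite /t /s; move: w_neq0; rewrite /w /orientation => w_neq0.
by congr (_, _); field; rewrite w_neq0.
Qed.

Lemma interleaved_crossing (i j k l : 'I_n.+1) : interleaved i j k l ->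
  crossing V (i, j) (k, l).
Proof.
move=> /andP[/andP[ik kj] jl].
by rewrite /crossing /=; apply: open_segment_meet; apply: hV; lia.
Qed.

Lemma non_crossingP (D : {set 'I_n.+1 * 'I_n.+1}) : dissection D ->
  non_crossing V D <->
  (forall i j k l, (i, j) \in D -> (k, l) \in D -> ~~ interleaved i j k l).
Proof.
move=> disD; split=> [nc i j k l ijD klD|ni [i j] [k l] ijD klD ne cr].
  apply/negP => int; apply: (nc _ _ ijD klD); last exact: interleaved_crossing.
  by case=> ik jl; move: int; rewrite /interleaved ik; lia.
have /andP[ij _] := disD _ ijD; have /andP[kl _] := disD _ klD.
have := crossing_interleaved ij kl ne cr.
by rewrite (negbTE (ni _ _ _ _ ijD klD)) (negbTE (ni _ _ _ _ klD ijD)).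
Qed.

End Geometry.

(** * Interval posets as dissections *)

Lemma eq_tq_free n (E E' : rel nat) :
  (forall a b, a < b <= n -> E a b = E' a b) -> 0 < n ->
  tq_free n E -> tq_free n E'.
Proof.
move=> eqE n_gt0 [Es El En Et Eq]; split.
- by move=> i i_n; rewrite -eqE ?Es // ltnSn.
- by rewrite -eqE ?n_gt0 ?leqnn.
- by move=> i j k l ikj jln; rewrite -!eqE; [exact: En| lia..].
- by move=> i j k ij jkn; rewrite -!eqE; [exact: Et| lia..].
- by move=> i j k l ij jk kln; rewrite -!eqE; [exact: Eq| lia..].
Qed.

Lemma tq_free_interval_rel n (p : 'S_n) : block_wise_simple p ->
  tq_free n (interval_rel p).
Proof.
move/block_wise_simpleP => tf; have p_inj := @position_inj _ p; split.
- by move=> i _; apply/asboolP; apply: gapfree1.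
- by apply/asboolP; apply: gapfree_full.
- move=> i j k l ikj jln /asboolP Gij /asboolP Gkl.
  exact: triangle_free_nested Gij Gkl.
- exact: tf.
- move=> i j k l ij jk kln /asboolP Gij /asboolP Gjk /asboolP Gkl /asboolP Gil.
  have [G|G] := gapfree_three p_inj ij jk kln Gij Gjk Gkl Gil.
    by apply/orP; left; apply/asboolP.
  by apply/orP; right; apply/asboolP.
Qed.

(** Only the relative order of the positions matters, so the standardization of
    [g] serves as the inverse of the permutation. *)
Lemma gapfree_realized n (g : nat -> nat) : {in gtn n &, injective g} ->
  exists p : 'S_n, forall a b, a < b <= n ->
    gapfree n (position p) a b <-> gapfree n g a b.
Proof.
move=> g_inj.
have inj_f : injective (fun i : 'I_n => g i).
  by move=> i j /g_inj; rewrite !inE !ltn_ord => /(_ isT isT)/val_inj.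
have [q qE] := standardization inj_f; exists (q^-1)%g => a b abn.
have pos x y : x < n -> y < n ->
    (position q^-1 x < position q^-1 y) = (g x < g y).
  move=> xn yn; have := qE (Ordinal xn) (Ordinal yn).
  by rewrite -{1 2}[q]invgK -!positionE.
by split=> G x y z xn yI zI yxz; apply: (G x y z) => //;
  move: yxz; rewrite !pos //; lia.
Qed.

Definition edge_rel n (D : {set 'I_n.+1 * 'I_n.+1}) : rel nat :=
  fun a b => graph_edge D (inord a) (inord b).

Lemma edge_relE n (D : {set 'I_n.+1 * 'I_n.+1}) (a b : 'I_n.+1) :
  edge_rel D a b = graph_edge D a b.
Proof. by rewrite /edge_rel !inord_val. Qed.

Lemma dissection_ext n (D D' : {set 'I_n.+1 * 'I_n.+1}) :
  dissection D -> dissection D' ->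
  (forall a b, a < b <= n -> edge_rel D a b = edge_rel D' a b) -> D = D'.
Proof.
move=> dis dis' eqE; apply/setP => -[a b]; have := eqE a b.
have bn : b <= n by rewrite -ltnS.
rewrite !edge_relE /graph_edge bn andbT => {}eqE.
have [/andP[/= ab /negbTE out]|not_diag] := boolP (diagonal (a, b)).
  by have := eqE ab; rewrite out.
by rewrite (contraNF (dis _) not_diag) (contraNF (dis' _) not_diag).
Qed.

(** Non-crossing concerns diagonals only, but an outer edge is never interleaved
    with another edge, so the condition extends to all edges. *)
Lemma tq_free_dissectionsP (R : realFieldType) n (V : 'I_n.+1 -> R * R)
    (D : {set 'I_n.+1 * 'I_n.+1}) : convex_polygon V ->
  D \in tq_free_dissections V <-> dissection D /\ tq_free n (edge_rel D).
Proof.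
move=> hV; rewrite inE; split=> [/asboolP[dis nc nt nq]|[dis [Es El En Et Eq]]].
  split=> //; move/(non_crossingP hV dis): nc => nc.
  have ordE a : a <= n -> exists i : 'I_n.+1, a = i.
    by rewrite -ltnS => an; exists (Ordinal an).
  split.
  - move=> i i_n; rewrite /edge_rel /graph_edge /outer_edge /= !inordK ?eqxx //;
      lia.
  - by rewrite /edge_rel /graph_edge /outer_edge /= !inordK ?eqxx ?orbT; lia.
  - move=> i j k l ikj jln.
    have [|i' iE] := ordE i; first lia. have [|j' jE] := ordE j; first lia.
    have [|k' kE] := ordE k; first lia. have [|l' lE] := ordE l; first lia.
    subst; rewrite !edge_relE /graph_edge /outer_edge /=.
    move=> /orP[ijO|ijD] /orP[klO|klD]; try lia.
    by have := nc i' j' k' l' ijD klD; rewrite /interleaved; lia.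
  - move=> i j k ij jkn.
    have [|i' iE] := ordE i; first lia. have [|j' jE] := ordE j; first lia.
    have [|k' kE] := ordE k; first lia.
    subst; rewrite !edge_relE => ijE jkE ikE; apply: nt.
    by exists i', j', k'; split=> //; lia.
  - move=> i j k l ij jk kln.
    have [|i' iE] := ordE i; first lia. have [|j' jE] := ordE j; first lia.
    have [|k' kE] := ordE k; first lia. have [|l' lE] := ordE l; first lia.
    subst; rewrite !edge_relE => ijE jkE klE ilE.
    rewrite -[_ || _]negbK negb_or.
    apply/negP => /andP[ikE jlE]; apply: nq.
    by exists i', j', k', l'; split=> //; lia.
have le_n (i : 'I_n.+1) : i <= n by rewrite -ltnS.
apply/asboolP; split=> //.
- apply/(non_crossingP hV dis) => i j k l ijD klD; apply/negP => /andP[ikj jl].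
  apply: (En i j k l) => //; rewrite ?jl ?le_n //.
    by rewrite edge_relE /graph_edge ijD orbT.
  by rewrite edge_relE /graph_edge klD orbT.
- case=> a [b [c [ab bc]]]; rewrite -!edge_relE => -[abE bcE acE].
  by apply: (Et a b c) => //; rewrite bc le_n.
- case=> a [b [c [d [ab bc cd]]]].
  rewrite -!edge_relE => -[abE bcE cdE adE] [nac nbd].
  have := Eq a b c d ab bc; rewrite cd le_n => /(_ isT abE bcE cdE adE).
  by rewrite (negbTE nac) (negbTE nbd).
Qed.

Lemma dissection_Phi n (P : {set {set 'I_n}}) : dissection (Phi P).
Proof. by move=> e; rewrite inE => /andP[]. Qed.

(** The outer edges are not in the image of the poset, but the intervals that
    they stand for, the singletons and the whole set, are always present. *)
Lemma edge_rel_Phi n (p : 'S_n) a b : a < b <= n ->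
  edge_rel (Phi (interval_poset p)) a b = interval_rel p a b.
Proof.
move=> /andP[ab bn]; have an1 : a < n.+1 by lia.
have bn1 : b < n.+1 by lia.
rewrite -[a]/(val (Ordinal an1)) -[b]/(val (Ordinal bn1)) edge_relE /=.
rewrite /graph_edge; have [out|not_out] := boolP (outer_edge _).
  apply/esym/asboolP; case/orP: out => [/eqP /= ->|/andP[/= /eqP -> /eqP ->]].
    exact: gapfree1.
  exact: gapfree_full.
rewrite /= inE /diagonal not_out /= ab /=.
have an : a < n by lia.
have b1n : b.-1 < n by lia.
have b1E : b.-1.+1 = b by lia.
apply/existsP/idP => [[i /existsP[j /and3P[ij ijP /eqP[aE bE]]]]|abE].
  rewrite -interval_rel_in ?ab //.
  by move: ijP; rewrite /segment aE bE /bump /=.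
exists (Ordinal an); apply/existsP; exists (Ordinal b1n).
apply/and3P; split=> /=.
- by move: not_out; rewrite /outer_edge /=; lia.
- rewrite -interval_rel_in ?ab // in abE; move: abE.
  have -> : [set x : 'I_n | a <= x < b] = segment (Ordinal an) (Ordinal b1n).
    by rewrite /segment /= -[b in LHS]b1E.
  by [].
by apply/eqP; congr (_, _); apply: val_inj; rewrite //= /bump /=; lia.
Qed.

Lemma Phi_interval_poset_inj n (p q : 'S_n) :
  Phi (interval_poset p) = Phi (interval_poset q) ->
  interval_poset p = interval_poset q.
Proof.
move=> eqPhi.
have segE (a b : 'I_n) : a <= b ->
    (segment a b \in interval_poset p) = (segment a b \in interval_poset q).
  move=> ab; have abn : a < b.+1 <= n by rewrite ltnS ab ltn_ord.
  have memE (r : 'S_n) : (segment a b \in interval_poset r) =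
      edge_rel (Phi (interval_poset r)) a b.+1.
    transitivity (interval_rel r a b.+1); last exact/esym/edge_rel_Phi.
    exact: (interval_rel_in r abn).
  by rewrite (memE p) (memE q) eqPhi.
apply/setP => I; have [|not_seg] := boolP (consecutive I).
  by case/existsP=> a /existsP[b /andP[ab /eqP ->]]; apply: segE.
by rewrite !inE /is_interval (negbTE not_seg).
Qed.

Theorem theorem5p3 (n : nat) (hn : 2 <= n)
    (R : realFieldType) (V : 'I_n.+1 -> R * R) (hV : convex_polygon V) :
  [/\ {in block_wise_simple_posets n &, injective (@Phi n)},
      [set Phi P | P in block_wise_simple_posets n] = tq_free_dissections V
    & #|block_wise_simple_posets n| = #|tq_free_dissections V|].
Proof.
have n_gt0 : 0 < n by lia.
have Phi_inj : {in block_wise_simple_posets n &, injective (@Phi n)}.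
  move=> _ _ /imsetP[p _ ->] /imsetP[q _ ->].
  exact: Phi_interval_poset_inj.
have Phi_onto :
    [set Phi P | P in block_wise_simple_posets n] = tq_free_dissections V.
  apply/setP => D; apply/imsetP/idP.
    case=> _ /imsetP[p bws ->] ->; rewrite inE in bws; move/asboolP: bws => bws.
    apply/(tq_free_dissectionsP _ hV); split; first exact: dissection_Phi.
    apply: eq_tq_free n_gt0 (tq_free_interval_rel bws) => a b abn.
    by rewrite edge_rel_Phi.
  case/(tq_free_dissectionsP _ hV) => dis tqD.
  have [g g_inj gE] := tq_free_realized n_gt0 tqD.
  have [p pE] := gapfree_realized g_inj.
  have relE a b : a < b <= n -> interval_rel p a b = edge_rel D a b.
    by move=> abn; apply/asboolP/idP; rewrite pE // gE.
  have bws : block_wise_simple p.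
    apply/block_wise_simpleP => i j k ij jkn; rewrite !relE; try lia.
    exact: no_triangle tqD _ _ _ ij jkn.
  exists (interval_poset p).
    by apply/imsetP; exists p => //; rewrite inE; apply/asboolP.
  apply: dissection_ext => // [|a b abn]; first exact: dissection_Phi.
  by rewrite edge_rel_Phi // relE.
by split=> //; rewrite -Phi_onto (card_in_imset Phi_inj).
Qed.
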